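(* Let $X$ be an absolutely continuous random variable with probability density function $f$, cumulative distribution function $F$, support $(a,b)$ with $-\infty\le a<b<\infty$, finite second-order moment, reversed hazard rate $\phi$ and reversed aging intensity function $\overline L$. Then $$E\left[\frac{\overline L(X)}{\phi(X)}\right]\ \ge\ \frac{1}{E\left[\frac{\phi(X)}{\overline L(X)}\right]},$$ and equality holds if and only if, for some value of the parameter $\gamma>0$, $X$ follows the Type 3 extreme value distribution with cumulative distribution function $$F(t)=\begin{cases}e^{\gamma(t-b)}, & t\in(-\infty,b],\ b\ge 0,\\ 1, & \text{otherwise.}\end{cases}$$
   Context: The support of $X$ is $(a,b)$ where $a=\inf\{t:F(t)>0\}$ and $b=\sup\{t:F(t)<1\}$. The reversed hazard rate of $X$ is $\phi(t)=f(t)/F(t)$, where defined. The reversed aging intensity function of $X$ is $$\overline L(t)=\frac{(b-t)\,\phi(t)}{\int_t^b\phi(u)\,du}=\frac{(t-b)f(t)}{F(t)\ln F(t)},\qquad a<t<b.$$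
   Formalization: The condition b ≥ 0 in the displayed distribution function is dropped: equality also holds for F(t)=e^{γ(t−b)}, t ≤ b, when b < 0 (e.g. b = −1), so the claim as displayed fails for negative b. *)

(* Defs.v *)
From HB Require Import structures.
From mathcomp Require Import all_boot all_order all_algebra.
From mathcomp Require Import all_classical all_reals all_analysis.
Import Order.TTheory GRing.Theory Num.Theory.
Import numFieldNormedType.Exports.

Set Implicit Arguments.
Unset Strict Implicit.
Unset Printing Implicit Defensive.

Local Open Scope classical_set_scope.
Local Open Scope ring_scope.

Definition real_cdf (d : measure_display) (T : measurableType d) (R : realType)
    (P : probability T R) (X : {RV P >-> R}) (t : R) : R :=
  fine (cdf X t).

(* The existence of such an f is the absolute continuity of X; f is an
   arbitrary version of the density, which may vanish inside the support. *)
Definition is_density (d : measure_display) (T : measurableType d)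
    (R : realType) (P : probability T R) (X : {RV P >-> R}) (f : R -> R) : Prop :=
  [/\ measurable_fun [set: R] f,
      (forall t, 0 <= f t) &
      forall A : set R, measurable A ->
        distribution P X A = (\int[lebesgue_measure]_(t in A) (f t)%:E)%E].

Definition support_inf (d : measure_display) (T : measurableType d)
    (R : realType) (P : probability T R) (X : {RV P >-> R}) : \bar R :=
  ereal_inf (EFin @` [set t | 0 < real_cdf X t]).

Definition support_sup (d : measure_display) (T : measurableType d)
    (R : realType) (P : probability T R) (X : {RV P >-> R}) : \bar R :=
  ereal_sup (EFin @` [set t | real_cdf X t < 1]).

(* Meaningful only where the cdf is positive; elsewhere the value is 0. *)
Definition reversed_hazard_rate (d : measure_display) (T : measurableType d)
    (R : realType) (P : probability T R) (X : {RV P >-> R}) (f : R -> R)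
    (t : R) : R :=
  f t / real_cdf X t.

(* Meaningful only for t in the support (a, b), where the integral, equal to
   - ln (F t), is finite and positive. X lies in (a, b) with probability 1, so
   the values outside do not affect expectations of functions of X. *)
Definition reversed_aging_intensity (d : measure_display) (T : measurableType d)
    (R : realType) (P : probability T R) (X : {RV P >-> R}) (f : R -> R)
    (b t : R) : R :=
  (b - t) * reversed_hazard_rate X f t /
  \int[lebesgue_measure]_(u in `]t, b[) reversed_hazard_rate X f u.

(* The location b may have any sign. *)
Definition type3_extreme_value_cdf (R : realType) (gamma b t : R) : R :=
  if t <= b then expR (gamma * (t - b)) else 1.

(* Main.v *)
(* On the support, the integral of the reversed hazard rate over ]t, b[ is
   - ln (F t), so L(X) / phi(X) is almost surely Y = (b - X) / - ln (F X), which
   is positive, and phi(X) / L(X) = Y^-1. For c = 1 / E[Y^-1], expanding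
   0 <= E[(Y - c)^2 / Y] gives E[Y] >= c, with equality iff Y = c almost surely,
   i.e. F(X) = exp ((X - b) / c) almost surely. Since F is continuous, the
   values of F on any set of full measure are dense in (0, 1), and this forces
   F t = exp ((t - b) / c) for every t < b, even where the density vanishes. *)
Require Import Defs.
From HB Require Import structures.
From mathcomp Require Import all_boot all_order all_algebra.
From mathcomp Require Import all_classical all_reals all_analysis.
From mathcomp Require Import measurable_realfun ring lra.
Import Order.TTheory GRing.Theory Num.Theory.
Import numFieldNormedType.Exports.

Local Open Scope classical_set_scope.
Local Open Scope ring_scope.

Set Implicit Arguments.
Unset Strict Implicit.

(** * Measurability of zero sets and of inverses *)

Lemma measurable_eq0 (d : measure_display) (T : measurableType d)
    (R : realType) (g : T -> R) :
  measurable_fun [set: T] g -> measurable [set t | g t = 0].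
Proof.
move=> mg; rewrite -[X in measurable X]setTI.
exact: (mg measurableT _ (measurable_set1 0)).
Qed.

(** On nonnegative reals, 0 included, inversion agrees with the power of exponent [-1], which is
    measurable. *)
Lemma measurable_fun_inv_ge0 (d : measure_display) (T : measurableType d)
    (R : realType) (D : set T) (g : T -> R) :
  (forall x, 0 <= g x) -> measurable_fun D g ->
  measurable_fun D (fun x => (g x)^-1).
Proof.
move=> g0 mg.
rewrite (_ : (fun x => _) = (fun x => g x `^ (-1))); last first.
  by apply/funext => x; rewrite powR_inv1.
exact: (measurableT_comp (measurable_powR _)).
Qed.

(** * Comparison of the arithmetic and harmonic means of a random variable *)

Section harmonic_mean.
Context {d : measure_display} {T : measurableType d} {R : realType}.
Variables (P : probability T R) (Y : T -> R).
Hypothesis Y_ge0 : forall w, 0 <= Y w.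
Hypothesis mY : measurable_fun [set: T] Y.
Hypothesis Y_gt0 : {ae P, forall w, 0 < Y w}.
Local Open Scope ereal_scope.

Let invY_ge0 w : (0 <= (Y w)^-1)%R. Proof. by rewrite invr_ge0. Qed.

Let minvY : measurable_fun [set: T] (fun w => (Y w)^-1%R).
Proof. exact: measurable_fun_inv_ge0. Qed.

Lemma expectation_eq0_ae (Z : T -> R) : (forall w, 0 <= Z w)%R ->
  measurable_fun [set: T] Z -> 'E_P[Z] = 0 -> {ae P, forall w, Z w = 0%R}.
Proof.
move=> Z0 mZ EZ0.
have : \int[P]_w `|(Z w)%:E| = 0.
  rewrite -EZ0 unlock; apply: eq_integral => w _.
  by rewrite gee0_abs// lee_fin.
move/(@ae_eq_integral_abs _ _ _ P _ measurableT _ _).1.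
move=> /(_ (proj2 (measurable_EFinP _ _) mZ)).
by apply: filterS => w /(_ I) [].
Qed.

(** A zero expectation would make [Z] both null and positive almost everywhere, which is impossible
    in a space of mass 1. *)
Lemma expectation_ae_gt0 (Z : T -> R) : (forall w, 0 <= Z w)%R ->
  measurable_fun [set: T] Z -> {ae P, forall w, (0 < Z w)%R} -> 0 < 'E_P[Z].
Proof.
move=> Z0 mZ Zgt0; rewrite lt0e expectation_ge0// andbT; apply/eqP => EZ0.
have Zae0 := expectation_eq0_ae Z0 mZ EZ0.
have PT : 0 < P [set: T] by rewrite probability_setT lte01.
have PF := ae_properfilter_algebraOfSetsType PT.
have : {ae P, forall w : T, False}.
  by apply: filterS2 Zae0 Zgt0 => w ->; rewrite ltxx.
by move=> /(@filter_ex _ _ PF)[].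
Qed.

(** This integrates the expanded square divided by [Y], an identity valid wherever [Y] is nonzero.
    Each side is a sum of nonnegative terms, so infinite expectations cause no trouble. *)
Let expectation_square_div (c : R) : (0 <= c)%R ->
  'E_P[fun w => ((Y w - c) ^+ 2 / Y w)%R] + (2 * c)%:E =
  'E_P[Y] + (c ^+ 2)%:E * 'E_P[fun w => (Y w)^-1%R].
Proof.
move=> c0.
have mQ : measurable_fun [set: T] (fun w => ((Y w - c) ^+ 2 / Y w)%R).
  apply: measurable_funM => //; apply: measurable_funX.
  exact: measurable_funB.
have meY : measurable_fun [set: T] (fun w => (Y w)%:E).
  exact/measurable_EFinP.
have meV : measurable_fun [set: T] (fun w => ((Y w)^-1)%:E).
  exact/measurable_EFinP.
have meQ : measurable_fun [set: T] (fun w => ((Y w - c) ^+ 2 / Y w)%:E).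
  exact/measurable_EFinP.
have mecV : measurable_fun [set: T] (fun w => (c ^+ 2)%:E * ((Y w)^-1)%:E).
  exact: emeasurable_funM.
have c2 : 0 <= (c ^+ 2)%:E by rewrite lee_fin sqr_ge0.
have Q0 w : 0 <= ((Y w - c) ^+ 2 / Y w)%:E.
  by rewrite lee_fin mulr_ge0// sqr_ge0.
rewrite unlock -[(2 * c)%:E]mule1 -(@probability_setT _ _ _ P).
rewrite -integral_cst// -ge0_integralZl//; last by move=> w _; rewrite lee_fin.
rewrite -ge0_integralD//; last by move=> w _; rewrite lee_fin mulr_ge0.
rewrite -ge0_integralD//; last 2 first.
- by move=> w _; rewrite lee_fin.
- by move=> w _; rewrite mule_ge0// lee_fin.
apply: ae_eq_integral => //.
- exact: emeasurable_funD.
- exact: emeasurable_funD.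
apply: filterS Y_gt0 => w Yw _; rewrite -!EFinM -!EFinD /=; congr (_%:E).
by field; rewrite gt_eqF.
Qed.

Let invE_fin_num : 'E_P[fun w => (Y w)^-1%R] != +oo ->
  exists2 r : R, (0 < r)%R & 'E_P[fun w => (Y w)^-1%R] = r%:E.
Proof.
have : 0 < 'E_P[fun w => (Y w)^-1%R].
  apply: expectation_ae_gt0 => //.
  by apply: filterS Y_gt0 => w; rewrite invr_gt0.
case: ('E_P[_]) => // r; rewrite lte_fin => r0 _.
by exists r.
Qed.

(** For [c = r^-1] the term [c ^+ 2 * r] collapses to [c], which is finite and can be subtracted
    even when ['E_P[Y]] is infinite. *)
Let expectationE (r : R) : (0 < r)%R -> 'E_P[fun w => (Y w)^-1%R] = r%:E ->
  'E_P[Y] = 'E_P[fun w => ((Y w - r^-1) ^+ 2 / Y w)%R] + (r^-1)%:E.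
Proof.
move=> r0 Er; have r1 : (0 <= r^-1)%R by rewrite invr_ge0 ltW.
have := expectation_square_div r1; rewrite Er -EFinM.
have -> : ((r^-1 ^+ 2 * r) = r^-1)%R by field; rewrite gt_eqF.
move=> /(congr1 (fun x => x - (r^-1)%:E)).
rewrite addeK// => <-; rewrite -addeA -EFinB; congr (_ + _%:E); ring.
Qed.

Lemma harmonic_mean_le : ('E_P[fun w => (Y w)^-1%R])^-1 <= 'E_P[Y].
Proof.
(* An infinite ['E_P[Y^-1]] has inverse 0, and the bound is trivial. *)
have [->|/invE_fin_num[r r0 Er]] := eqVneq ('E_P[fun w => (Y w)^-1%R]) +oo.
  by rewrite invey expectation_ge0.
rewrite (expectationE r0 Er) Er inver gt_eqF// leeDr// expectation_ge0// => w.
by rewrite mulr_ge0// sqr_ge0.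
Qed.

Lemma harmonic_mean_eq : 'E_P[Y] = ('E_P[fun w => (Y w)^-1%R])^-1 <->
  exists c : R, (0 < c)%R /\ {ae P, forall w, Y w = c}.
Proof.
split=> [EY|[c [c0 Yc]]]; last first.
  have -> : 'E_P[Y] = 'E_P[cst c].
    rewrite unlock; apply: ae_eq_integral => //.
    + exact/measurable_EFinP.
    + exact/measurable_EFinP/measurable_cst.
    by apply: filterS Yc => w /= ->.
  have -> : 'E_P[fun w => (Y w)^-1%R] = 'E_P[cst c^-1%R].
    rewrite unlock; apply: ae_eq_integral => //.
    + exact/measurable_EFinP.
    + exact/measurable_EFinP/measurable_cst.
    by apply: filterS Yc => w /= ->.
  by rewrite !expectation_cst inver invr_eq0 gt_eqF// invrK.
(* In the infinite case the equality would give ['E_P[Y] = 0], against the positivity of [Y]. *)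
have [Ey|/invE_fin_num[r r0 Er]] := eqVneq ('E_P[fun w => (Y w)^-1%R]) +oo.
  have := expectation_ae_gt0 Y_ge0 mY Y_gt0.
  by rewrite EY Ey invey ltxx.
exists r^-1%R; split; first by rewrite invr_gt0.
pose Q w := ((Y w - r^-1) ^+ 2 / Y w)%R.
have Q0 w : (0 <= Q w)%R by rewrite mulr_ge0// sqr_ge0.
have mQ : measurable_fun [set: T] Q.
  apply: measurable_funM => //; apply: measurable_funX.
  exact: measurable_funB.
have EQ0 : 'E_P[Q] = 0.
  move: EY; rewrite (expectationE r0 Er) Er inver gt_eqF//.
  move=> /(congr1 (fun x => x - (r^-1)%:E)).
  by rewrite addeK// subee.
(* [Q] also vanishes where [Y] does, since division by 0 gives 0; positivity of [Y] excludes this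
   case. *)
apply: filterS2 (expectation_eq0_ae Q0 mQ EQ0) Y_gt0 => w /eqP.
rewrite mulf_eq0 invr_eq0 sqrf_eq0 subr_eq0 => /orP[/eqP//|/eqP ->].
by rewrite ltxx.
Qed.

End harmonic_mean.

(** * Continuity and values of the distribution function of a variable with a density *)

Section cdf_of_density.
Context {d : measure_display} {T : measurableType d} {R : realType}.
Variables (P : probability T R) (X : {RV P >-> R}) (f : R -> R).
Hypothesis Xf : is_density X f.

Local Notation F := (real_cdf X).
Local Notation mu := (@lebesgue_measure R).

Let mf : measurable_fun [set: R] f. Proof. by case: Xf. Qed.
Let f_ge0 t : 0 <= f t. Proof. by case: Xf. Qed.
Let distE (A : set R) : measurable A ->
  distribution P X A = (\int[mu]_(t in A) (f t)%:E)%E.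
Proof. by case: Xf => _ _; exact. Qed.

Lemma real_cdfE t : (F t)%:E = distribution P X `]-oo, t].
Proof. by rewrite /real_cdf fineK// fin_num_measure. Qed.

Lemma real_cdf_ge0 (t : R) : 0 <= F t.
Proof. by rewrite -lee_fin real_cdfE. Qed.

Lemma real_cdf_le1 (t : R) : F t <= 1.
Proof. by rewrite -lee_fin real_cdfE cdf_le1. Qed.

Lemma real_cdf_nondecreasing : {homo F : x y / x <= y}.
Proof. by move=> x y xy; rewrite -lee_fin !real_cdfE cdf_nondecreasing. Qed.

Let mF : measurable_fun [set: R] F.
Proof. exact: nondecreasing_measurable real_cdf_nondecreasing. Qed.

Lemma density_integrable (A : set R) :
  measurable A -> mu.-integrable A (EFin \o f).
Proof.
move=> mA; apply: (@integrableS _ _ _ mu [set: R]) => //.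
apply/integrableP; split; first exact/measurable_EFinP.
under eq_integral do rewrite /= ger0_norm//.
by rewrite -distE// probability_setT ltry.
Qed.

Lemma real_cdf_Rintegral (t : R) : F t = \int[mu]_(u in `]-oo, t]) f u.
Proof. by rewrite /real_cdf /cdf distE. Qed.

Lemma Rintegral_density_itv (x y : R) : x <= y ->
  \int[mu]_(u in `]x, y]) f u = F y - F x.
Proof.
move=> xy; rewrite !real_cdf_Rintegral Rintegral_itvB//.
exact: density_integrable.
Qed.

(** Around [x], [F] is a constant plus the integral of an integrable function up to a variable
    endpoint. *)
Lemma real_cdf_continuous : continuous F.
Proof.
move=> x.
have x1 : x - 1 < x + 1 by lra.
apply: (@within_continuous_continuous _ _ _ (x - 1) (x + 1)) => //; last first.
  by rewrite in_itv/=; apply/andP; split; lra.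
pose G y := F (x - 1) + \int[mu]_(u in `[x - 1, y]) f u.
apply: (@subspace_eq_continuous _ _ _ G).
  move=> y; rewrite inE/= in_itv/= => /andP[xy _]; rewrite /G.
  rewrite -Rintegral_itv_obnd_cbnd; last exact: density_integrable.
  by rewrite Rintegral_density_itv// addrC subrK.
move=> y; apply: cvgD; first exact: cvg_cst.
apply: parameterized_integral_continuous; first exact: ltW.
exact: density_integrable.
Qed.

Lemma real_cdf_attains (v : R) : 0 < v < 1 -> exists x, F x = v.
Proof.
move=> /andP[v0 v1].
have [M [_ HM]] := cvgr_gt 1 (fine_cvg (cvg_cdfy1 X)) v v1.
have [N [_ HN]] := cvgr_lt 0 (fine_cvg (cvg_cdfNy0 X)) v v0.
(* The limit bounds hold strictly beyond [M] and [N], hence the shifts by 1. *)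
have vM : v < F (M + 1) by apply: HM; lra.
have vN : F (N - 1) < v by apply: HN; lra.
have NM : N - 1 <= M + 1.
  rewrite leNgt; apply/negP => /ltW/real_cdf_nondecreasing; lra.
have [||x _ <-] := @IVT R F (N - 1) (M + 1) v NM; last by exists x.
  exact: continuous_subspaceT real_cdf_continuous.
have ? := real_cdf_nondecreasing NM.
by rewrite min_l// max_r//; apply/andP; split; exact: ltW.
Qed.

Lemma real_cdf_between (x y v : R) : x <= y -> F x <= v <= F y ->
  exists2 z, x <= z <= y & F z = v.
Proof.
move=> xy /andP[xv vy]; have [||z] := @IVT R F x y v xy.
- exact: continuous_subspaceT real_cdf_continuous.
- have ? := real_cdf_nondecreasing xy.
  by rewrite min_l// max_r//; apply/andP.
- by rewrite in_itv/=; exists z.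
Qed.

Lemma prob_density0 : P (X @^-1` [set t | f t = 0]) = 0%E.
Proof.
have m0 := measurable_eq0 mf.
rewrite -[LHS]/(distribution P X _) distE//.
by apply: integral0_eq => t /= ->.
Qed.

(** The zero set of [F] lies to the left of every point where [F] is positive. If it had mass
    [p > 0], a point with [F x = p / 2] would give [p <= p / 2]. *)
Lemma prob_cdf0 : P (X @^-1` [set t | F t = 0]) = 0%E.
Proof.
have m0 := measurable_eq0 mF.
rewrite -[LHS]/(distribution P X _).
have D_fin : distribution P X [set t | F t = 0] \is a fin_num.
  by rewrite fin_num_measure.
rewrite -(fineK D_fin); set p := fine _; congr (_%:E).
have p1 : p <= 1 by rewrite -lee_fin /p fineK// probability_le1.
have : 0 <= p by rewrite -lee_fin /p fineK.
rewrite le_eqVlt => /predU1P[//|p0].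
have [|x Fx] := @real_cdf_attains (p / 2); first by apply/andP; split; lra.
suff : p <= F x by rewrite Fx; lra.
rewrite -lee_fin real_cdfE /p fineK// le_measure ?inE// => t /= Ft.
rewrite in_itv/= leNgt; apply/negP => /ltW/real_cdf_nondecreasing.
rewrite Ft Fx; lra.
Qed.

(** * The integral of the reversed hazard rate as an increment of [ln F] *)

Local Notation phi := (reversed_hazard_rate X f).

Lemma reversed_hazard_rate_ge0 (t : R) : 0 <= phi t.
Proof. by rewrite divr_ge0// real_cdf_ge0. Qed.

Lemma measurable_reversed_hazard_rate : measurable_fun [set: R] phi.
Proof.
apply: measurable_funM => //.
by apply: measurable_fun_inv_ge0 => // t; exact: real_cdf_ge0.
Qed.

Lemma reversed_hazard_rate_integrable (x y : R) : 0 < F x ->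
  mu.-integrable `]x, y] (EFin \o phi).
Proof.
move=> Fx.
have : mu.-integrable `]x, y] (fun u => ((F x)^-1)%:E * (f u)%:E)%E.
  by apply: integrableZl => //; exact: density_integrable.
apply: le_integrable => //=.
- apply/measurable_EFinP.
  exact: measurable_funS measurable_reversed_hazard_rate.
- move=> u /=; rewrite in_itv/= => /andP[/ltW/real_cdf_nondecreasing xu _].
  rewrite lee_fin !ger0_norm ?reversed_hazard_rate_ge0//; last first.
    by rewrite mulr_ge0// invr_ge0 ltW.
  rewrite /reversed_hazard_rate mulrC ler_wpM2r// lef_pV2 ?posrE//.
  exact: lt_le_trans xu.
Qed.

(** By monotonicity of [F], [phi u] lies between [f u / F y] and [f u / F x] on the interval. *)
Lemma Rintegral_reversed_hazard_rate_bounds (x y : R) : x <= y -> 0 < F x ->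
  (F y - F x) / F y <= \int[mu]_(u in `]x, y]) phi u <= (F y - F x) / F x.
Proof.
move=> xy Fx; have Fxy := real_cdf_nondecreasing xy.
have If : mu.-integrable `]x, y] (EFin \o f) by exact: density_integrable.
have Icf c : mu.-integrable `]x, y] (EFin \o (fun u => c * f u)).
  exact: (integrableZl _ c If).
have Iphi := reversed_hazard_rate_integrable y Fx.
rewrite -(Rintegral_density_itv xy) ![_ / F _]mulrC -!RintegralZl//.
apply/andP; split; apply: le_Rintegral => // u /=; rewrite in_itv/= =>
  /andP[/ltW/real_cdf_nondecreasing xu /real_cdf_nondecreasing uy];
  rewrite /reversed_hazard_rate [leRHS]mulrC;
  rewrite ?[f u / _]mulrC ler_wpM2r// lef_pV2 ?posrE//; lra.
Qed.

(* Both sides lie between [1 - F x / F y] and [F y / F x - 1], which differ by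
   a quantity quadratic in [F y - F x]; bisecting the increment of [F] halves
   the bound. *)
Lemma Rintegral_reversed_hazard_rate_approx (c : R) (n : nat) (x y : R) :
  x <= y -> 0 < c -> c <= F x ->
  `|\int[mu]_(u in `]x, y]) phi u - (ln (F y) - ln (F x))| <=
  ((F y - F x) / c) ^+ 2 / 2 ^+ n.
Proof.
move=> + c0; elim: n x y => [|n IHn] x y xy cx.
  have Fx : 0 < F x by lra.
  have Fxy := real_cdf_nondecreasing xy.
  have Fy : 0 < F y by lra.
  have /andP[lo hi] := Rintegral_reversed_hazard_rate_bounds xy Fx.
  rewrite -ln_div ?posrE// expr0 divr1.
  (* Both logarithmic bounds are [ln (1 + q) <= q], applied to [F y / F x] here and to the inverse
     ratio next. *)
  have lnhi : ln (F y / F x) <= (F y - F x) / F x.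
    rewrite [X in ln X](_ : _ = 1 + (F y - F x) / F x); last first.
      by field; rewrite gt_eqF.
    have q0 : 0 <= (F y - F x) / F x by apply: divr_ge0; lra.
    by apply: le_ln1Dx; lra.
  have lnlo : (F y - F x) / F y <= ln (F y / F x).
    rewrite -[F y / F x]invrK invf_div lnV ?posrE ?divr_gt0// lerNr.
    rewrite [X in ln X](_ : _ = 1 + - ((F y - F x) / F y)); last first.
      by field; rewrite gt_eqF.
    by apply: le_ln1Dx; rewrite ltrN2 ltr_pdivrMr// mul1r; lra.
  have quad : (F y - F x) / F x - (F y - F x) / F y <= ((F y - F x) / c) ^+ 2.
    rewrite [leLHS](_ : _ = (F y - F x) ^+ 2 * (F x * F y)^-1); last first.
      by field; rewrite !gt_eqF.
    rewrite expr_div_n ler_wpM2l ?sqr_ge0//.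
    rewrite lef_pV2 ?posrE ?mulr_gt0 ?exprn_gt0//.
    by rewrite expr2 ler_pM//; lra.
  rewrite ler_norml; apply/andP; split; lra.
have Fxy := real_cdf_nondecreasing xy.
(* The cut is made where [F] takes the mean of its end values: each piece has half the increment,
   hence a quarter of its square, and the two pieces add up to half the bound. *)
have [|z /andP[xz zy] Fz] := @real_cdf_between x y ((F x + F y) / 2) xy.
  by apply/andP; split; lra.
have cz : c <= F z by rewrite (le_trans cx)// real_cdf_nondecreasing.
have IH1 := IHn _ _ xz cx; have IH2 := IHn _ _ zy cz.
have Fx : 0 < F x by lra.
have Iphi := reversed_hazard_rate_integrable y Fx.
have := @Rintegral_itvB _ phi (BRight x) (BRight y) z Iphi.
rewrite !bnd_simp => /(_ xz zy)/eqP; rewrite subr_eq => /eqP ->.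
rewrite [X in `|X|](_ : _ =
  (\int[mu]_(u in `]x, z]) phi u - (ln (F z) - ln (F x))) +
  (\int[mu]_(u in `]z, y]) phi u - (ln (F y) - ln (F z)))); last by ring.
apply: le_trans (ler_normD _ _) _; apply: le_trans (lerD IH1 IH2) _.
have -> : F z - F x = (F y - F x) / 2 by lra.
have -> : F y - F z = (F y - F x) / 2 by lra.
rewrite le_eqVlt; apply/orP; left; apply/eqP; rewrite [2 ^+ n.+1]exprS.
have : (2 ^+ n : R) != 0 by rewrite expf_neq0.
move: (2 ^+ n) (F y - F x) => p q p0.
by field; rewrite p0 gt_eqF.
Qed.

(** The error [e] does not depend on [n], while its bound [K / 2 ^+ n] tends to 0. *)
Lemma Rintegral_reversed_hazard_rate (x y : R) : x <= y -> 0 < F x ->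
  \int[mu]_(u in `]x, y]) phi u = ln (F y) - ln (F x).
Proof.
move=> xy Fx; apply/eqP; rewrite -subr_eq0 -normr_le0 leNgt; apply/negP.
set e := `|_| => e0; set K := ((F y - F x) / F x) ^+ 2.
have eK n : e * 2 ^+ n <= K.
  by rewrite -ler_pdivlMr ?exprn_gt0// Rintegral_reversed_hazard_rate_approx.
have := eK (Num.Def.archi_bound (K / e)); rewrite leNgt mulrC -ltr_pdivrMr//.
by move=> /negP; apply; apply: upper_nthrootP.
Qed.

(** Take [x] and [y] where [F] reaches the levels one third and two thirds of the way from [u] to
    [v]. The interval between them has probability [(v - u) / 3 > 0], so a set of full measure must
    meet it. *)
Lemma real_cdf_ae_dense (Q : set R) (u v : R) : {ae P, forall w, Q (X w)} ->
  0 <= u -> u < v -> v <= 1 -> exists t, Q t /\ u < F t < v.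
Proof.
move=> Qae u0 uv v1.
have [|x Fx] := @real_cdf_attains ((2 * u + v) / 3).
  by apply/andP; split; lra.
have [|y Fy] := @real_cdf_attains ((u + 2 * v) / 3).
  by apply/andP; split; lra.
have xy : x <= y.
  rewrite leNgt; apply/negP => /ltW/real_cdf_nondecreasing; rewrite Fx Fy; lra.
apply: contrapT => noQ.
have : distribution P X `]x, y] = 0%E.
  have mI : measurable (X @^-1` `]x, y]) by exact: measurable_funPTI.
  apply/(negligibleP P mI).
  apply: negligibleS Qae => w /=; rewrite in_itv/= => /andP[xw wy] Qw.
  apply: noQ; exists (X w); split => //.
  have := real_cdf_nondecreasing (ltW xw); have := real_cdf_nondecreasing wy.
  by rewrite Fx Fy => ? ?; apply/andP; split; lra.
move=> /(congr1 fine); rewrite distE// -[LHS]/(Rintegral _ _ _).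
by rewrite Rintegral_density_itv// Fx Fy /=; lra.
Qed.

(** * Behaviour at the right endpoint of the support *)

Section support.
Variable b : R.
Hypothesis supp_b : support_sup X = b%:E.

Lemma real_cdf_lt1 (t : R) : t < b -> F t < 1.
Proof.
move=> tb; rewrite ltNge; apply/negP => F1.
suff : (b%:E <= t%:E)%E by rewrite lee_fin leNgt tb.
rewrite -supp_b; apply: ge_ereal_sup => _ [s /= Fs <-].
rewrite lee_fin leNgt; apply/negP => /ltW/real_cdf_nondecreasing; lra.
Qed.

Lemma real_cdf_gt_sup (t : R) : b < t -> F t = 1.
Proof.
move=> bt; apply/le_anti; rewrite real_cdf_le1/= leNgt; apply/negP => F1.
suff : (t%:E <= b%:E)%E by rewrite lee_fin leNgt bt.
by rewrite -supp_b; apply: ereal_sup_ubound; exists t.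
Qed.

(** [F] is 1 to the right of [b], so a jump at [b] would leave the level [(F b + 1) / 2] unattained,
    against continuity. *)
Lemma real_cdf_sup : F b = 1.
Proof.
apply/le_anti; rewrite real_cdf_le1/= leNgt; apply/negP => Fb.
have bb1 : b < b + 1 by lra.
have Fb1 := real_cdf_gt_sup bb1.
have [||z /andP[+ _] Fz] := @real_cdf_between b (b + 1) ((F b + 1) / 2).
- exact: ltW.
- by rewrite Fb1; apply/andP; split; lra.
rewrite le_eqVlt => /predU1P[zb|/real_cdf_gt_sup].
  by move: Fz; rewrite -zb; lra.
by rewrite Fz; lra.
Qed.

Lemma prob_ge_sup : P (X @^-1` `[b, +oo[) = 0%E.
Proof.
rewrite -[LHS]/(distribution P X _) distE//.
(* The point [b] carries no mass, so the closed ray may be opened and becomes the complement of the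
   event measured by [F b]. *)
rewrite -integral_itv_obnd_cbnd; last first.
  by apply/measurable_EFinP; exact: measurable_funS mf.
rewrite -distE// -[LHS]/(ccdf X b) ccdf_1_cdf.
by rewrite /cdf -real_cdfE real_cdf_sup subee.
Qed.

Lemma Rintegral_reversed_hazard_rate_sup (t : R) : t <= b -> 0 < F t ->
  \int[mu]_(u in `]t, b[) phi u = - ln (F t).
Proof.
move=> tb Ft; rewrite Rintegral_itv_bndo_bndc; last first.
  apply: integrableS (reversed_hazard_rate_integrable b Ft) => //.
  by apply: subset_itvl; rewrite bnd_simp.
by rewrite Rintegral_reversed_hazard_rate// real_cdf_sup ln1 sub0r.
Qed.

(** * The ratio of the reversed aging intensity to the reversed hazard rate *)

Local Notation L := (reversed_aging_intensity X f b).

Lemma aging_ratioE (t : R) : f t != 0 -> F t != 0 -> t < b ->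
  L t / phi t = (b - t) / - ln (F t).
Proof.
move=> ft Ft tb; have Fgt0 : 0 < F t by rewrite lt0r Ft real_cdf_ge0.
rewrite /reversed_aging_intensity Rintegral_reversed_hazard_rate_sup ?ltW//.
by rewrite mulrAC mulfK// /reversed_hazard_rate mulf_neq0// invr_eq0.
Qed.

(* Where f or F vanishes, or beyond b, the conventions on division by 0 make
   the ratio 0. *)
Lemma aging_ratio_ifE (t : R) : L t / phi t =
  if [&& f t != 0, F t != 0 & t < b] then (b - t) / - ln (F t) else 0.
Proof.
case: ifPn => [/and3P[]|]; first exact: aging_ratioE.
rewrite !negb_and !negbK -leNgt /reversed_aging_intensity.
move=> /or3P[/eqP ft|/eqP Ft|bt].
- have -> : phi t = 0 by rewrite /reversed_hazard_rate ft mul0r.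
  by rewrite invr0 mulr0.
- have -> : phi t = 0 by rewrite /reversed_hazard_rate Ft invr0 mulr0.
  by rewrite invr0 mulr0.
- by rewrite set_itv_ge ?bnd_simp -?leNgt// Rintegral_set0 invr0 mulr0 mul0r.
Qed.

Lemma aging_ratio_ge0 (t : R) : 0 <= L t / phi t.
Proof.
rewrite aging_ratio_ifE; case: ifP => // /and3P[_ _ tb].
apply: divr_ge0; first by rewrite subr_ge0 ltW.
by rewrite oppr_ge0 ln_le0 ?real_cdf_le1.
Qed.

(** The closed form avoids proving that an integral depends measurably on its lower endpoint. *)
Lemma measurable_aging_ratio : measurable_fun [set: R] (fun t => L t / phi t).
Proof.
rewrite (_ : (fun _ => _) = (fun t => if [&& f t != 0, F t != 0 & t < b]
  then (b - t) / - ln (F t) else 0)); last exact/funext/aging_ratio_ifE.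
apply: measurable_fun_ifT => //.
- apply: measurable_and; first exact/measurable_neg/measurable_fun_eqr.
  apply: measurable_and; first exact/measurable_neg/measurable_fun_eqr.
  exact: measurable_fun_ltr.
- apply: measurable_funM; first exact: measurable_funB.
  apply: measurable_fun_inv_ge0.
    by move=> t; rewrite oppr_ge0 ln_le0// real_cdf_le1.
  apply: measurableT_comp => //; apply: measurableT_comp => //.
Qed.

Lemma ae_interior : {ae P, forall w, [/\ f (X w) != 0, F (X w) != 0 & X w < b]}.
Proof.
have ae_notin (A : set R) : measurable A -> P (X @^-1` A) = 0%E ->
    {ae P, forall w, ~ A (X w)}.
  move=> mA PA; exists (X @^-1` A); split => //; first exact: measurable_funPTI.
  by move=> w /= /contrapT.
have := ae_notin _ (measurable_itv `[b, +oo[) prob_ge_sup.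
apply: filterS3 (ae_notin _ (measurable_eq0 mf) prob_density0)
                (ae_notin _ (measurable_eq0 mF) prob_cdf0) => w /=.
move=> /eqP ? /eqP ?; rewrite in_itv/= andbT leNgt => /negP.
by rewrite negbK.
Qed.

Lemma ae_aging_ratio_gt0 : {ae P, forall w, 0 < L (X w) / phi (X w)}.
Proof.
apply: filterS ae_interior => w [f0 F0 wb]; rewrite aging_ratioE//.
rewrite divr_gt0 ?subr_gt0// oppr_gt0 ln_lt0// real_cdf_lt1// andbT.
by rewrite lt0r F0 real_cdf_ge0.
Qed.

(** The constant and the parameter are inverse to each other: a ratio equal to [c] means
    [ln (F t) = (t - b) / c]. *)
Lemma aging_ratio_ae_cst :
  (exists c : R, 0 < c /\ {ae P, forall w, L (X w) / phi (X w) = c}) <->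
  exists gamma : R, 0 < gamma /\
    forall t : R, F t = type3_extreme_value_cdf gamma b t.
Proof.
split=> [[c [c0 Lc]]|[gamma [g0 FE]]]; last first.
  exists gamma^-1; split; first by rewrite invr_gt0.
  apply: filterS ae_interior => w [f0 F0 wb]; rewrite aging_ratioE// FE.
  rewrite /type3_extreme_value_cdf ltW// expRK.
  by rewrite -mulrN opprB invfM mulrCA mulfV ?mulr1// subr_eq0 gt_eqF.
exists c^-1; split; first by rewrite invr_gt0.
pose G s := expR (c^-1 * (s - b)).
have Gae : {ae P, forall w, [set s | F s = G s] (X w)}.
  apply: filterS2 ae_interior Lc => w [f0 F0 wb]; rewrite aging_ratioE// => Lw.
  have Fw : 0 < F (X w) by rewrite lt0r F0 real_cdf_ge0.
  rewrite /= -[LHS]lnK ?posrE//; congr expR.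
  have lnF : ln (F (X w)) != 0 by rewrite lt_eqF// ln_lt0// Fw real_cdf_lt1.
  by rewrite -Lw; field; rewrite lnF subr_eq0 gt_eqF.
move=> t; rewrite /type3_extreme_value_cdf; case: ifPn => [tb|]; last first.
  by rewrite -ltNge => /real_cdf_gt_sup.
have G1 : G t <= 1.
  by rewrite -expR0 ler_expR mulr_ge0_le0// ?subr_le0// invr_ge0 ltW.
(* If [F t] and [G t] differ, some [s] with [F s = G s] has this common value strictly between them.
   Strict growth of [G] then tells on which side of [t] the point [s] lies, and monotonicity of [F]
   contradicts it. *)
have [lt_FG|lt_GF|//] := ltgtP (F t) (G t).
- have [s [/= Fs /andP[Fts]]] :=
    real_cdf_ae_dense Gae (real_cdf_ge0 t) lt_FG G1.
  rewrite Fs /G ltr_expR ltr_pM2l ?invr_gt0// ltrD2r.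
  by move=> /ltW/real_cdf_nondecreasing; rewrite leNgt Fts.
- have [s [/= Fs /andP[+ Fst]]] :=
    real_cdf_ae_dense Gae (expR_ge0 _) lt_GF (real_cdf_le1 t).
  rewrite Fs /G ltr_expR ltr_pM2l ?invr_gt0// ltrD2r.
  by move=> /ltW/real_cdf_nondecreasing; rewrite leNgt Fst.
Qed.

End support.

End cdf_of_density.

Unset Implicit Arguments.
Set Strict Implicit.

Theorem theorem4p3 (R : realType) (d : measure_display) (T : measurableType d)
    (P : probability T R) (X : {RV P >-> R}) (f : R -> R) (a : \bar R) (b : R)
    (Xf : is_density X f)
    (supp_a : support_inf X = a) (supp_b : support_sup X = b%:E)
    (ltab : (a < b%:E)%E)
    (X2 : ('E_P[(fun w => X w ^+ 2)%R] < +oo)%E) :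
  let phi := reversed_hazard_rate X f in
  let L := reversed_aging_intensity X f b in
  ((('E_P[(fun w => phi (X w) / L (X w))%R])^-1
      <= 'E_P[(fun w => L (X w) / phi (X w))%R])%E) /\
  (('E_P[(fun w => L (X w) / phi (X w))%R]
      = ('E_P[(fun w => phi (X w) / L (X w))%R])^-1)%E <->
   exists gamma : R, 0 < gamma /\
     forall t : R, real_cdf X t = type3_extreme_value_cdf gamma b t).
Proof.
move=> phi L.
(* This holds at every [w], also where a denominator vanishes, because the inverse of 0 is 0. *)
have -> : (fun w => phi (X w) / L (X w)) = (fun w => (L (X w) / phi (X w))^-1).
  by apply/funext => w; rewrite [RHS]invf_div.
have Y0 w : 0 <= L (X w) / phi (X w) by exact: aging_ratio_ge0.
have mY : measurable_fun [set: T] (fun w => L (X w) / phi (X w)).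
  apply: (measurableT_comp (measurable_aging_ratio Xf supp_b)).
  exact: measurable_funPT.
have Ypos := ae_aging_ratio_gt0 Xf supp_b.
split; first exact: harmonic_mean_le.
by rewrite -(aging_ratio_ae_cst Xf supp_b); exact: harmonic_mean_eq.
Qed.
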